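(* Let $k\ge 2$ and let $H=(V,E)$ be a $k$-uniform tree. Then $\mathrm{pmd}(H)=\Delta(H)$.
   Context: A hypergraph $H=(V,E)$ is $k$-uniform if every edge has exactly $k$ vertices. For $v\in V$, $\deg_H(v)=|\{e\in E: v\in e\}|$ and $\Delta(H)=\max_{v\in V}\deg_H(v)$. A $k$-uniform hypergraph $H=(V,E)$ ($k\ge2$) is a tree if (T1) $|e\cap e'|\le 1$ for all distinct edges $e,e'\in E$, and (T2) for each pair of vertices $v,v'\in V$ such that no edge contains both, there is a unique sequence of edges $e_1,\dots,e_r\in E$ with (a) $v\in e_1$, $v'\in e_r$ and $v,v'\notin e_2,\dots,e_{r-1}$; (b) $|e_i\cap e_{i+1}|=1$ for $1\le i\le r-1$; (c) $e_i\cap e_j=\varnothing$ whenever $|i-j|\ge 2$. A matching is a set $M\subseteq E$ of pairwise disjoint edges. A positive matching of $H$ is a matching $M$ for which there exists $\mathfrak{w}:V\to\mathbb{R}$ with $\sum_{i\in e}\mathfrak{w}(i)>0$ for all $e\in M$ and $\sum_{i\in e}\mathfrak{w}(i)<0$ for all $e\in E\setminus M$. A positive matching decomposition (pmd) of $H$ is a partition $E=E_1\cup\dots\cup E_p$ such that for each $i$, $E_i$ is a positive matching of the hypergraph $(V,E\setminus\bigcup_{j<i}E_j)$. $\mathrm{pmd}(H)$ is the smallest $p$ for which $H$ admits a pmd with $p$ parts.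
   Formalization: It is additionally assumed that H has at most one edge or that some two distinct vertices lie in no common edge; otherwise (T2) is vacuous and the claim fails, e.g. for the triangle K_3, where Δ=2 but pmd=3. *)

(* Defs.v *)
From mathcomp Require Import all_boot all_order all_algebra.
From mathcomp Require Import reals.

Set Implicit Arguments.
Unset Strict Implicit.
Unset Printing Implicit Defensive.

Import GRing.Theory Num.Theory.

(* A hypergraph on the finite vertex set V is given by its set of edges
   E : {set {set V}}. *)

Section Hypergraphs.
Variable V : finType.
Implicit Types (E F M : {set {set V}}) (v : V) (s : seq {set V}).

Definition uniform (k : nat) E : Prop := forall e, e \in E -> #|e| = k.

Definition degree E v : nat := #|[set e in E | v \in e]|.

Definition max_degree E : nat := \max_(v : V) degree E v.

Definition joined E v v' : bool := [exists e in E, (v \in e) && (v' \in e)].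

(* The sequence e_1, ..., e_r is s with indices shifted by one, so e_i is
   nth set0 s i.-1 and r = size s >= 1. *)
Definition edge_path E v v' s : Prop :=
  [/\ 0 < size s,
      forall e, e \in s -> e \in E,
      [/\ v \in nth set0 s 0,
          v' \in nth set0 s (size s).-1
        & forall i, 0 < i < (size s).-1 ->
            v \notin nth set0 s i /\ v' \notin nth set0 s i],
      forall i, i.+1 < size s -> #|nth set0 s i :&: nth set0 s i.+1| = 1
    & forall i j, i.+2 <= j < size s -> nth set0 s i :&: nth set0 s j = set0].

Definition tree E : Prop :=
  (forall e e', e \in E -> e' \in E -> e != e' -> #|e :&: e'| <= 1) /\
  (forall v v', v != v' -> ~~ joined E v v' ->
     exists! s, edge_path E v v' s).

(* [tree] also holds for every linear space (any two distinct vertices lie in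
   exactly one common edge), its second condition being vacuous there.  For a
   linear space with at least two edges, such as the triangle K_3, the pmd
   number exceeds the maximum degree: if max_degree positive matchings
   decomposed it they would all be perfect, so the weight sum over V would be
   positive by the first one and negative by the others.  This predicate
   excludes exactly those cases; every acyclic E satisfying [tree] meets it. *)
Definition not_linear_space E : Prop :=
  #|E| <= 1 \/ exists v v', v != v' /\ ~~ joined E v v'.

Variable R : realType.

Definition positive_matching F M : Prop :=
  [/\ M \subset F,
      trivIset M
    & exists w : V -> R,
        (forall e, e \in M -> 0 < \sum_(i in e) w i)%R /\
        (forall e, e \in F :\: M -> \sum_(i in e) w i < 0)%R].

(* Injectivity of P and [partition] together say that the P i are nonempty,
   pairwise disjoint and cover E. *)
Definition pm_decomposition E (p : nat) (P : 'I_p -> {set {set V}}) : Prop :=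
  [/\ injective P,
      partition [set P i | i : 'I_p] E
    & forall i : 'I_p,
        positive_matching (E :\: \bigcup_(j < p | j < i) P j) (P i)].

Definition has_pmd E (p : nat) : Prop :=
  exists P : 'I_p -> {set {set V}}, pm_decomposition E P.

(* pmd(E) = p *)
Definition pmd_is E (p : nat) : Prop :=
  has_pmd E p /\ forall q, has_pmd E q -> p <= q.

End Hypergraphs.

Arguments positive_matching {V} R F M.
Arguments pm_decomposition {V} R E {p} P.
Arguments has_pmd {V} R E p.
Arguments pmd_is {V} R E p.

(* Main.v *)
Require Import Defs.
From mathcomp Require Import all_boot all_order all_algebra.
From mathcomp Require Import reals.

(** Uniqueness of edge paths excludes induced cycles, except that triangles can
    survive inside a linear space, the case ruled out by [not_linear_space].
    Hence every nonempty set of edges contains a leaf edge, one sharing at most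
    one vertex with the others.  Peeling off leaf edges, every sign pattern on
    the edges is realised by vertex weights, because a leaf edge has a private
    vertex whose weight sets its sum freely; so every matching is positive.
    In the reverse order a greedy colouring is proper with the maximum degree
    many colours, because the earlier edges meeting a new edge all pass through
    one vertex of it. *)

Set Implicit Arguments.
Unset Strict Implicit.
Unset Printing Implicit Defensive.

Import GRing.Theory Num.Theory.

(** * Linear hypergraphs: distinct edges share at most one vertex *)

Section Linear.
Variables (V : finType) (E : {set {set V}}).
Hypothesis linE :
  forall e e', e \in E -> e' \in E -> e != e' -> #|e :&: e'| <= 1.

Lemma linear_eq e e' x y : e \in E -> e' \in E -> x != y ->
  x \in e -> y \in e -> x \in e' -> y \in e' -> e = e'.
Proof.
move=> eE e'E xy xe ye xe' ye'; apply/eqP/negPn/negP=> /(linE eE e'E) le1.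
have := subset_leq_card (_ : [set x; y] \subset e :&: e').
rewrite cards2 xy leqNgt ltnS => /(_ _)/negP; apply=> //.
by apply/subsetP=> z /set2P[] ->; rewrite inE ?xe ?ye.
Qed.

Lemma linear_cap1 e e' x : e \in E -> e' \in E -> e != e' ->
  x \in e -> x \in e' -> #|e :&: e'| = 1.
Proof.
move=> eE e'E ne xe xe'; apply/eqP; rewrite eqn_leq linE //= card_gt0.
by apply/set0Pn; exists x; rewrite inE xe.
Qed.

(** Since [v] and [v'] are not joined, [e1] and [e2] differ, so linearity makes [u] their only
    common vertex. *)
Lemma edge_path2 v v' e1 e2 u : e1 \in E -> e2 \in E -> ~~ joined E v v' ->
  v \in e1 -> v' \in e2 -> u \in e1 -> u \in e2 ->
  edge_path E v v' [:: e1; e2].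
Proof.
move=> e1E e2E nj ve1 ve2 ue1 ue2; split=> //=.
- by move=> e; rewrite !inE => /orP[] /eqP->.
- by split=> // -[].
- case=> // _; apply: (@linear_cap1 _ _ u) => //.
  apply: contra nj => /eqP e12; apply/existsP; exists e1.
  by rewrite e1E ve1 (e12 : e1 = e2).
- by move=> i [|[|j]] //; rewrite andbF.
Qed.

Lemma joinedP x y :
  reflect (exists2 e, e \in E & x \in e /\ y \in e) (joined E x y).
Proof.
apply: (iffP existsP) => [[e /and3P[]]|[e eE [xe ye]]]; first by exists e.
by exists e; rewrite eE xe.
Qed.

Lemma joinedC x y : joined E x y = joined E y x.
Proof. by apply/joinedP/joinedP=> -[e eE []]; exists e. Qed.

End Linear.

(** * Consequences of unique edge paths: triangles are collinear *)

Section Tree.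
Variables (V : finType) (E : {set {set V}}).
Hypothesis treeE : tree E.

Let linE := treeE.1.

Lemma edge_path_unique v v' s s' : v != v' -> ~~ joined E v v' ->
  edge_path E v v' s -> edge_path E v v' s' -> s = s'.
Proof.
move=> vv' nj ps ps'; have [t [_ tu]] := treeE.2 v v' vv' nj.
by rewrite -(tu _ ps) -(tu _ ps').
Qed.

(** Each common neighbour gives a two-edge path from [x] to [y]. These paths coincide, so two
    different neighbours would both lie in both edges; linearity would identify the edges, joining
    [x] to [y]. *)
Lemma common_neighbour_unique x y u u' : x != y -> ~~ joined E x y ->
  joined E x u -> joined E u y -> joined E x u' -> joined E u' y -> u = u'.
Proof.
move=> xy nj /joinedP[e1 e1E [xe1 ue1]] /joinedP[e2 e2E [ue2 ye2]].
move=> /joinedP[f1 f1E [xf1 uf1]] /joinedP[f2 f2E [uf2 yf2]].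
have [e1f1 e2f2] : e1 = f1 /\ e2 = f2.
  have pe := edge_path2 linE e1E e2E nj xe1 ye2 ue1 ue2.
  have pf := edge_path2 linE f1E f2E nj xf1 yf2 uf1 uf2.
  by case: (edge_path_unique xy nj pe pf).
apply/eqP/negPn/negP=> uu'; subst f1 f2.
have e12 := linear_eq linE e1E e2E uu' ue1 uf1 ue2 uf2.
by case/negP: nj; apply/joinedP; exists e1 => //; rewrite {2}e12.
Qed.

(** If no edge crossed the boundary of [S], membership in [S] would spread from [v] through the
    successive edges, which meet, up to [v']. *)
Lemma edge_path_crossing (S : {set V}) v v' s :
  edge_path E v v' s -> v \in S -> v' \notin S ->
  exists e x y, [/\ e \in E, x \in e, y \in e, x \in S & y \notin S].
Proof.
move=> [s0 sE [v0 vl _] cap1 _] vS v'S.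
have [/exists_inP[e eE /exists_inP[x xe /exists_inP[y ye /andP[xS yS]]]]|none]
  := boolP [exists e in E, exists x in e, exists y in e, (x \in S) && (y \notin S)].
  by exists e, x, y.
have stay e x y : e \in E -> x \in e -> y \in e -> x \in S -> y \in S.
  move=> eE xe ye xS; apply: contraR none => yS.
  apply/exists_inP; exists e => //; apply/exists_inP; exists x => //.
  by apply/exists_inP; exists y => //; rewrite xS.
have sub i : i < size s -> {subset nth set0 s i <= S}.
  elim: i => [|i IHi] lti y yi.
    by apply: (stay (nth set0 s 0) v) => //; apply/sE/mem_nth.
  have /card_gt0P[x] : 0 < #|nth set0 s i :&: nth set0 s i.+1| by rewrite cap1.
  rewrite inE => /andP[xi xi1].
  apply: (stay (nth set0 s i.+1) x) => //; first exact/sE/mem_nth.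
  by apply: (IHi (ltnW lti)).
by case/negP: v'S; apply: (sub (size s).-1) => //; rewrite prednK.
Qed.

(* If [a], [b], [c] formed a triangle, the common neighbours [S] of [a] and [b]
   would form a clique, and a vertex outside [S] would have at most one
   neighbour in [S].  An edge leaving [S] at [s] then reaches any other [t] of
   [S] both along the line [s t] and along a detour inside [S]. *)
Lemma triangle_collinear a b c v v' : v != v' -> ~~ joined E v v' ->
  joined E a b -> joined E b c -> joined E a c ->
  exists2 e, e \in E & [/\ a \in e, b \in e & c \in e].
Proof.
move=> vv' njv jab jbc jac.
have [/exists_inP[e eE /and3P[ae be ce]]|noncol]
  := boolP [exists e in E, [&& a \in e, b \in e & c \in e]]; first by exists e.
have joinedxx x y : joined E x y -> joined E x x.
  by case/joinedP=> e eE [xe _]; apply/joinedP; exists e.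
have jaa := joinedxx _ _ jab.
have jbb : joined E b b by apply: joinedxx jbc.
have ab : a != b.
  apply: contraNneq noncol => ab; have /joinedP[e eE [ae ce]] := jac.
  by apply/exists_inP; exists e => //; rewrite -ab ae ce.
pose S := [set x | joined E x a && joined E x b].
have aS : a \in S by rewrite inE jaa jab.
have bS : b \in S by rewrite inE joinedC jab.
have cS : c \in S by rewrite inE joinedC jac joinedC.
(* Two non-joined members of [S] would have [a] and [b] as distinct common neighbours. *)
have clique x y : x \in S -> y \in S -> x != y -> joined E x y.
  rewrite !inE => /andP[xa xb] /andP[ya yb] xy; apply: contraNT ab => nj.
  apply/eqP; apply: (common_neighbour_unique xy nj) => //.
    by rewrite joinedC.
  by rewrite joinedC.
(* One of [a], [b] is not joined to [p]; call it [q]. As [S] is a clique, [s] and [u] are both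
   common neighbours of [p] and [q]. *)
have outside p s u : p \notin S -> s \in S -> u \in S ->
    joined E p s -> joined E p u -> s = u.
  move=> pS sS uS ps pu.
  have [q qS npq] : exists2 q, q \in S & ~~ joined E p q.
    by move: pS; rewrite inE negb_and => /orP[]; [exists a | exists b].
  have pq : p != q by apply: contraNneq pS => ->.
  apply: (common_neighbour_unique pq npq) => //; apply: clique => //.
    by apply: contraNneq npq => <-.
  by apply: contraNneq npq => <-.
have lineS e x y z : e \in E -> x != y -> x \in e -> y \in e -> z \in e ->
    x \in S -> y \in S -> z \in S.
  move=> eE xy xe ye ze xS yS; apply: contraNT xy => zS; apply/eqP.
  by apply: (outside z) => //; apply/joinedP; exists e.
have [e [s [p [eE se pe sS pS]]]] :
    exists e x y, [/\ e \in E, x \in e, y \in e, x \in S & y \notin S].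
  have [w wS] : exists w, w \notin S.
    case: (boolP (v \in S)) => [vS|]; last by exists v.
    by exists v'; apply: contra njv => v'S; apply: clique.
  have aw : a != w by apply: contraNneq wS => <-.
  case: (boolP (joined E a w)) => [/joinedP[e eE [ae we]]|nj].
    by exists e, a, w.
  by have [t [pt _]] := treeE.2 a w aw nj; apply: edge_path_crossing pt _ _.
have [t tS ts] : exists2 t, t \in S & t != s.
  case: (eqVneq a s) => [<-|]; last by exists a.
  by exists b => //; rewrite eq_sym.
have /joinedP[f fE [tf sf]] := clique t s tS sS ts.
have [u uS uf] : exists2 u, u \in S & u \notin f.
  case: (boolP (a \in f)) => [af|]; last by exists a.
  case: (boolP (b \in f)) => [bf|]; last by exists b.
  exists c => //; apply: contra noncol => cf.
  by apply/exists_inP; exists f => //; rewrite af bf cf.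
have us : u != s by apply: contraNneq uf => ->.
have ut : u != t by apply: contraNneq uf => ->.
have /joinedP[g gE [ug sg]] := clique u s uS sS us.
have /joinedP[h hE [uh th]] := clique u t uS tS ut.
have pt : p != t by apply: contraNneq pS => ->.
have njpt : ~~ joined E p t.
  apply/negP=> jpt; case/eqP: ts; apply: (outside p) => //.
  by apply/joinedP; exists e.
have pg : p \notin g.
  by apply: contra pS => pg; apply: (lineS g u s).
have tg : t \notin g.
  apply: contra uf => tg.
  by rewrite (linear_eq linE fE gE ts tf sf tg sg).
have path2 := edge_path2 linE eE fE njpt pe tf se sf.
have path3 : edge_path E p t [:: e; g; h].
  split=> //=.
  - by move=> d; rewrite !inE => /or3P[] /eqP->.
  - by split=> // -[|[|]].
  - case=> [|[|//]] _ /=.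
      by apply: (linear_cap1 linE eE gE _ se sg); apply: contraNneq pg => <-.
    by apply: (linear_cap1 linE gE hE _ ug uh); apply: contraNneq tg => ->.
  - move=> [|i] [|[|[|j]]] //= _; last by rewrite nth_nil setI0.
    (* A common vertex of [e] and [h] lies in [S], so it is [s], the only neighbour of [p] there.
       Then [h] and [f] share [s] and [t], yet [f] misses [u]. *)
    apply/eqP; apply: contraT => /set0Pn[z /setIP[ze zh]].
    have zS : z \in S by apply: (lineS h u t).
    have zs : z = s.
      by apply: (outside p) => //; apply/joinedP; exists e.
    case/negP: uf; rewrite zs in zh.
    by rewrite (linear_eq linE fE hE ts tf sf th zh).
by have := edge_path_unique pt njpt path2 path3.
Qed.


(** * Induced paths of edges and the existence of a leaf edge *)

Definition induced_path (F : {set {set V}}) (s : seq {set V}) : Prop :=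
  [/\ uniq s, {subset s <= F},
      forall i, i.+1 < size s -> nth set0 s i :&: nth set0 s i.+1 != set0
    & forall i j, i.+2 <= j < size s -> nth set0 s i :&: nth set0 s j = set0].

Definition leafless (F : {set {set V}}) : Prop :=
  forall e, e \in F -> 1 < #|e :&: cover (F :\ e)|.

(** A path that enters [e] through [x] can leave it elsewhere: of two vertices of [e] shared with
    other edges, one differs from [x]. *)
Lemma leafless_exit F e x : leafless F -> e \in F ->
  exists y (f : {set V}), [/\ y != x, y \in e, y \in f, f \in F & f != e].
Proof.
move=> ll /ll/card_gt1P[y1 [y2 [y1e y2e y12]]].
have [y ye yx] : exists2 y, y \in e :&: cover (F :\ e) & y != x.
  case: (eqVneq y1 x) => [<-|]; last by exists y1.
  by exists y2 => //; rewrite eq_sym.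
move: ye; rewrite inE => /andP[ye /bigcupP[f]].
by rewrite !inE => /andP[fe fF] yf; exists y, f.
Qed.

(* An edge [f] leaving the head [e] outside [e'] extends the path unless it
   hits the tail; the first hit closes a triangle or an induced cycle, and the
   latter yields two edge paths between the non-joined [x] and [z]. *)
Lemma induced_path_extend (F : {set {set V}}) e e' s v v' : v != v' -> ~~ joined E v v' ->
  F \subset E -> leafless F -> induced_path F [:: e, e' & s] ->
  exists f, induced_path F [:: f, e, e' & s].
Proof.
move=> vv' njv /subsetP FE ll [us sF consec disj].
have eF : e \in F by apply: sF; rewrite mem_head.
have e'F : e' \in F by apply: sF; rewrite !inE eqxx orbT.
have ee' : e != e' by move: us; rewrite /= inE negb_or -andbA => /andP[].
have /set0Pn[x /setIP[xe xe']] := consec 0 isT; rewrite /= in xe xe'.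
have [y [f [yx ye yf fF fe]]] := leafless_exit x ll eF.
have ye' : y \notin e'.
  apply: contra ee' => ye'; apply/eqP.
  exact: (linear_eq linE (FE _ eF) (FE _ e'F) yx).
have [t Et] : {t | t = e' :: s} by exists (e' :: s).
rewrite -Et in us sF consec disj *.
pose a (g : {set V}) := f :&: g != set0.
have [ha|/hasPn nha] := boolP (has a t); last first.
  exists f; split.
  - rewrite cons_uniq us andbT inE (negPf fe) /=.
    (* Were [f] in [t], it would meet itself in [y]. *)
    apply/negP=> /nha /negP; apply; apply/set0Pn; exists y.
    by rewrite inE yf.
  - by move=> g; rewrite inE => /predU1P[->|/sF].
  - move=> [|i]; last exact: consec.
    by move=> _; apply/set0Pn; exists y; rewrite inE yf.
  - move=> [|i] [|j] //; last exact: disj.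
    case: j => // j ltj; apply/eqP; rewrite -[_ == _]negbK.
    by apply: nha; apply: mem_nth.
have tF : {subset t <= F} by move=> g gt; apply: sF; rewrite inE gt orbT.
set i := find a t; have lti : i < size t by rewrite -has_find.
pose g := nth set0 t i.
have gF : g \in F by apply/tF/mem_nth.
have /set0Pn[z /setIP[zf zg]] : f :&: g != set0 := nth_find set0 ha.
have before j : j < i -> f :&: nth set0 t j = set0.
  by move=> /(before_find set0)/negbFE/eqP.
have yz : joined E y z by apply/joinedP; exists f => //; apply: FE.
have xy : joined E x y by apply/joinedP; exists e => //; apply: FE.
have noxyz : z != y -> joined E x z -> z \in e.
  move=> zy xz; have [h hE [xh yh zh]] := triangle_collinear vv' njv xy yz xz.
  by rewrite (linear_eq linE (FE _ eF) hE yx ye xe yh xh).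
have nze : z != y -> z \notin e.
  move=> zy; apply: contra fe => ze; apply/eqP.
  exact: (linear_eq linE (FE _ fF) (FE _ eF) zy).
(* If the first hit is [e'], then [x], [y], [z] form a triangle on the line [e], so [e] and [f]
   share both [y] and [z]. *)
case: (posnP i) => [i0|i_gt0].
  have ge' : g = e' by rewrite /g i0 Et.
  have zy : z != y by apply: contraNneq ye' => <-; rewrite -ge'.
  case/negP: (nze zy); apply: noxyz => //.
  by apply/joinedP; exists e'; [apply: FE | rewrite -{2}ge'].
(* Index [i] of [t] is index [i.+1] of [e :: t], hence not adjacent to [e] when [i] is positive. *)
have eg : e :&: g = set0 by apply: (disj 0 i.+1); rewrite /= !ltnS i_gt0.
have notinIg u : u \in e -> u \in g -> False.
  by move=> ue ug; have := in_set0 u; rewrite -eg inE ue ug.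
have zy : z != y by apply/eqP=> zy; apply: (notinIg z); rewrite ?zy // -zy.
have xz : x != z by apply/eqP=> xz; apply: (notinIg z); rewrite // -xz.
have njxz : ~~ joined E x z by apply: contra (nze zy); apply: noxyz.
have path1 := edge_path2 linE (FE _ eF) (FE _ fF) njxz xe zf ye yf.
have size2 : size (take i.+1 t) = i.+1 by rewrite size_takel.
have path2 : edge_path E x z (take i.+1 t).
  have adj j : j.+1 < i.+1 -> j.+1 < size t.
    by move=> /leq_trans; apply.
  split; rewrite ?size2 //.
  - by move=> h /mem_take/tF/FE.
  - split.
    + by rewrite nth_take // Et.
    + by rewrite nth_take.
    move=> j /= /andP[j_gt0 ltji]; rewrite nth_take 1?ltnW //.
    split; apply/negP=> uj.
      have : x \in e :&: nth set0 t j by rewrite inE xe.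
      rewrite (disj 0 j.+1) ?inE //=.
      by rewrite ltnS j_gt0 ltnS (ltn_trans ltji).
    have : z \in f :&: nth set0 t j by rewrite inE zf.
    by rewrite before // inE.
  - move=> j ltj; rewrite !nth_take // 1?ltnW //.
    have /set0Pn[u /setIP[uj uj1]] := consec j.+1 (adj j ltj).
    apply: (linear_cap1 linE _ _ _ uj uj1) => /=.
    + by apply/FE/tF/mem_nth/ltnW/adj.
    + by apply/FE/tF/mem_nth/adj.
    have ut : uniq t by move: us => /= /andP[].
    by rewrite nth_uniq ?(ltnW (adj _ ltj)) ?adj // neq_ltn ltnSn.
  - move=> j l /andP[jl li]; rewrite !nth_take //; last first.
      by apply: leq_trans li; apply: ltnW; apply: ltnW.
    by apply: (disj j.+1 l.+1); rewrite ltnS jl ltnS (leq_trans li).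
(* The two paths start with the distinct edges [e] and [e']. *)
have := edge_path_unique xz njxz path1 path2.
by rewrite Et /= => -[/eqP]; rewrite (negPf ee').
Qed.

(** Without a leaf, induced paths extend indefinitely, yet being duplicate-free they have at most
    [#|F|] edges. The non-joined pair needed to extend them comes from [not_linear_space], whose
    other case leaves at most one edge. *)
Lemma exists_leaf (F : {set {set V}}) : not_linear_space E ->
  F \subset E -> F != set0 ->
  exists2 e, e \in F & #|e :&: cover (F :\ e)| <= 1.
Proof.
move=> nls FE F0; case: nls => [E1|[v [v' [vv' njv]]]].
  have /set0Pn[e eF] := F0; exists e => //.
  suff -> : F :\ e = set0 by rewrite /cover big_set0 setI0 cards0.
  apply/eqP; rewrite -cards_eq0 -leqn0 -ltnS (leq_trans _ E1) //.
  by rewrite [#|F :\ e|.+1](_ : _ = #|F|) ?subset_leq_card // (cardsD1 e F) eF.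
have [/exists_inP[e eF le1]|/exists_inPn noleaf]
  := boolP [exists e in F, #|e :&: cover (F :\ e)| <= 1]; first by exists e.
have ll : leafless F by move=> e /noleaf; rewrite -ltnNge.
have long n : exists s, induced_path F s /\ size s = n.+2.
  elim: n => [|n [[|e [|e' s]] [ps sz]]] //.
    have /set0Pn[e eF] := F0.
    have /card_gt1P[x _] := ll e eF.
    have [y [f [_ ye yf fF fe]]] := leafless_exit x ll eF.
    exists [:: f; e]; split=> //; split.
    + by rewrite /= inE fe.
    + by move=> h; rewrite !inE => /orP[]/eqP->.
    + by case=> // _; apply/set0Pn; exists y; rewrite inE yf.
    + by move=> i [|[|j]] //=; rewrite andbF.
  have [f pf] := induced_path_extend vv' njv FE ll ps.
  by exists [:: f, e, e' & s]; split=> //=; rewrite -sz.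
have [s [[us sF _ _] sz]] := long #|F|.
have : size s <= #|F|.
  by rewrite cardE uniq_leq_size // => h /sF; rewrite mem_enum.
by rewrite sz => /ltnW; rewrite ltnn.
Qed.

End Tree.

(** * Weights and colourings obtained by peeling leaf edges *)

Section LeafOrder.
Variables (V : finType) (E : {set {set V}}).

(** Quantifying over all nonempty subsets of [E] lets the property survive the deletion of an
    edge. *)
Definition peelable : Prop := forall F : {set {set V}},
  F \subset E -> F != set0 ->
  exists2 e, e \in F & #|e :&: cover (F :\ e)| <= 1.

Hypothesis peelE : peelable.

Lemma peelable_ind (P : {set {set V}} -> Prop) :
  P set0 ->
  (forall (F : {set {set V}}) e, F \subset E -> e \in F -> #|e :&: cover (F :\ e)| <= 1 ->
     P (F :\ e) -> P F) ->
  forall F : {set {set V}}, F \subset E -> P F.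
Proof.
move=> P0 PS F; move Dn: #|F| => n.
elim: n F Dn => [|n IHn] F Dn FE; first by rewrite (cards0_eq Dn).
have F0 : F != set0 by rewrite -card_gt0 Dn.
have [e eF le1] := peelE FE F0.
apply: (PS F e) => //; apply: IHn; last exact: subset_trans (subD1set _ _) FE.
by move: Dn; rewrite (cardsD1 e) eF => -[].
Qed.

Lemma sign_pattern_realizable (R : realType) (sgn : pred {set V}) :
  (forall e, e \in E -> 1 < #|e|) ->
  forall F : {set {set V}}, F \subset E ->
  exists w : V -> R, forall e, e \in F ->
    if sgn e then (0 < \sum_(i in e) w i)%R else (\sum_(i in e) w i < 0)%R.
Proof.
move=> gt1; apply: peelable_ind => [|F e FE eF le1 [w Hw]].
  by exists (fun=> 0%R) => e; rewrite inE.
(* The edge [e] has at least two vertices and shares at most one. *)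
have [x xe xF] : exists2 x, x \in e & x \notin cover (F :\ e).
  apply/subsetPn; apply/negP=> /setIidPl ecov.
  by move: le1; rewrite ecov leqNgt gt1 // (subsetP FE).
pose d : R := (if sgn e then 1 else -1)%R.
(* This value makes the sum over [e] equal to [d]; no other edge of [F] contains [x], so the other
   sums are unchanged. *)
pose wx := (d - \sum_(i in e | i != x) w i)%R.
exists (fun i => if i == x then wx else w i) => f fF.
have [->|fe] := eqVneq f e.
  rewrite (bigD1 x) //= eqxx.
  rewrite (eq_bigr w); last by move=> i /andP[_ /negPf ->].
  by rewrite /wx subrK /d; case: (sgn e); rewrite ?ltr01 ?ltrN10.
have fFe : f \in F :\ e by rewrite !inE fe.
rewrite (eq_bigr w); first exact: Hw.
move=> i fi; case: eqP => // ix; case/negP: xF; apply/bigcupP.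
by exists f => //; rewrite -ix.
Qed.

(** Writing the palette as ['I_D.+1] keeps it inhabited, as the empty edge set still needs a
    colouring function. *)
Lemma edge_coloring (D : nat) :
  (forall e, e \in E -> 0 < #|e|) -> (forall v, degree E v <= D.+1) ->
  forall F : {set {set V}}, F \subset E ->
  exists c : {set V} -> 'I_D.+1,
    forall e f v, e \in F -> f \in F -> v \in e -> v \in f -> c e = c f -> e = f.
Proof.
move=> gt0 degD; apply: peelable_ind => [|F e FE eF le1 [c Hc]].
  by exists (fun=> ord0) => e f v; rewrite inE.
(* If [e] meets no other edge, any of its vertices serves. *)
have [x xe xF] : exists2 x, x \in e &
    forall f y, f \in F :\ e -> y \in e -> y \in f -> x \in f.
  have incap f y : f \in F :\ e -> y \in e -> y \in f ->
      y \in e :&: cover (F :\ e).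
    by move=> fF ye yf; rewrite inE ye; apply/bigcupP; exists f.
  have [cap0|/set0Pn[x xcap]] := eqVneq (e :&: cover (F :\ e)) set0.
    have /card_gt0P[x xe] := gt0 e (subsetP FE e eF).
    by exists x => // f y fF ye yf; have := incap f y fF ye yf; rewrite cap0 inE.
  exists x; first by case/setIP: xcap.
  move=> f y fF ye yf.
  by rewrite (card_le1_eqP le1 _ _ (incap f y fF ye yf) xcap).
pose A := [set f in F :\ e | x \in f].
(* The edge [e] counts towards the degree of [x] but is not in [A], which leaves a colour free. *)
have ltA : #|A| < D.+1.
  apply: leq_trans (degD x); apply: proper_card; apply/properP; split.
    by apply/subsetP=> f; rewrite !inE => /andP[/andP[_ /(subsetP FE) ->]].
  by exists e; rewrite !inE ?eqxx ?(subsetP FE).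
have [k kA] : exists k, k \notin c @: A.
  apply/existsP; rewrite -negb_forall; apply/negP=> /forallP all.
  have : #|'I_D.+1| <= #|c @: A| by apply/subset_leq_card/subsetP=> i _.
  by rewrite card_ord leqNgt (leq_ltn_trans (leq_imset_card _ _)).
have new f v : f \in F -> f != e -> v \in e -> v \in f -> c f != k.
  move=> fF fe ve vf; apply: contraNneq kA => <-; apply: imset_f.
  have fFe : f \in F :\ e by rewrite !inE fe.
  by rewrite inE fFe (xF f v).
exists (fun f => if f == e then k else c f) => f g v fF gF vf vg.
have [fe|fe] := eqVneq f e; have [ge|ge] := eqVneq g e.
- by rewrite fe ge.
- by move=> kg; have := new g v gF ge; rewrite -kg eqxx -fe => /(_ vf vg).
- by move=> kg; have := new f v fF fe; rewrite kg eqxx -ge => /(_ vg vf).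
- by apply: (Hc f g v) => //; rewrite !inE ?fe ?ge.
Qed.

End LeafOrder.

(** * Lower and upper bounds on the pmd number *)

Lemma card_bigcup_le (I T : finType) (A : I -> {set T}) :
  #|\bigcup_i A i| <= \sum_i #|A i|.
Proof.
elim/big_rec2: _ => [|i n B _ le]; first by rewrite cards0.
by rewrite (leq_trans (leq_card_setU _ _)) // leq_add2l.
Qed.

(** Each part is a matching, so it accounts for at most one of the edges at [v]. *)
Lemma has_pmd_max_degree_le (R : realType) (V : finType) (E : {set {set V}}) q :
  has_pmd R E q -> max_degree E <= q.
Proof.
move=> [P [_ /and3P[/eqP covP _ _] posP]]; apply/bigmax_leqP=> v _.
pose A := [set e in E | v \in e].
have subA : A \subset \bigcup_i (A :&: P i).
  apply/subsetP=> e eA; have : e \in E by move: eA; rewrite inE => /andP[].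
  rewrite -covP => /bigcupP[_ /imsetP[i _ ->] ePi].
  by apply/bigcupP; exists i; rewrite // inE eA.
apply: leq_trans (subset_leq_card subA) _.
apply: leq_trans (card_bigcup_le _) _.
rewrite -[leqRHS]card_ord -sum1_card; apply: leq_sum => i _.
have [_ /trivIsetP triv _] := posP i.
apply/card_le1_eqP=> e f; rewrite !inE => /andP[/andP[_ ve] ePi].
move=> /andP[/andP[_ vf] fPi]; apply/eqP; apply: contraT => ef.
have /pred0P/(_ v) := triv f e fPi ePi ef.
by rewrite /= ve vf.
Qed.

(** The parts are the colour classes, in any order: each is a matching, and its weights realise the
    sign pattern positive on the class and negative on the remaining edges. *)
Lemma peelable_has_pmd (R : realType) (V : finType) (E : {set {set V}}) :
  (forall e, e \in E -> 1 < #|e|) -> peelable E -> has_pmd R E (max_degree E).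
Proof.
move=> gt1 peelE; have gt0 e : e \in E -> 0 < #|e| by move/gt1/ltnW.
have degle v : degree E v <= max_degree E by apply: leq_bigmax.
(* The colouring needs a nonempty palette; maximum degree zero means no edges, as edges are
   nonempty. *)
case Dd: (max_degree E) => [|D].
  have E0 : E = set0.
    apply/setP=> e; rewrite inE; apply/negP=> eE.
    have /card_gt0P[v ve] := gt0 e eE.
    have := degle v; rewrite Dd leqn0 cards_eq0 => /eqP/setP/(_ e).
    by rewrite !inE eE ve.
  exists (fun=> set0); split; [by case | | by case].
  rewrite E0 /partition /cover; apply/and3P; split.
  - by apply/eqP/big1 => B /imsetP[[]].
  - by apply/trivIsetP=> B C /imsetP[[]].
  - by apply/imsetP=> -[[]].
have degD v : degree E v <= D.+1 by rewrite -Dd.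
have [c Hc] := edge_coloring peelE gt0 degD (subxx E).
have [v degv] : exists v, degree E v = D.+1.
  have V0 : 0 < #|V|.
    case: (posnP #|V|) => // V0; move: Dd; rewrite /max_degree big_pred0 //.
    by move=> v; have := card0_eq V0 v.
  by have [v] := eq_bigmax (degree E) V0; rewrite -/(max_degree E) Dd; exists v.
pose P i := [set e in E | c e == i].
have inP e : e \in E -> e \in P (c e) by move=> eE; rewrite inE eE /=.
(* A partition has no empty part. The edges at a vertex of maximum degree have distinct colours, so
   they exhaust the palette. *)
have Pn0 i : exists e, e \in P i.
  have : i \in c @: [set e in E | v \in e].
    suff -> : c @: [set e in E | v \in e] = setT by rewrite inE.
    apply/eqP; rewrite eqEcard subsetT cardsT card_ord.
    rewrite card_in_imset; first by rewrite /= -degv.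
    move=> e f; rewrite !inE => /andP[eE ve] /andP[fE vf].
    exact: (Hc e f v).
  case/imsetP=> e; rewrite inE => /andP[eE _] ->.
  by exists e; apply: inP.
have Pdisj i j e : e \in P i -> e \in P j -> i = j.
  by rewrite !inE => /andP[_ /eqP <-] /andP[_ /eqP].
exists P; split.
- by move=> i j Pij; have [e ePi] := Pn0 i; apply: (Pdisj i j e); rewrite -?Pij.
- apply/and3P; split.
  + apply/eqP/setP=> e; apply/bigcupP/idP => [[_ /imsetP[i _ ->]]|eE].
      by rewrite inE => /andP[].
    by exists (P (c e)); [apply: imset_f | apply: inP].
  + apply/trivIsetP=> _ _ /imsetP[i _ ->] /imsetP[j _ ->] nij.
    apply/pred0P=> e /=; apply/negP=> /andP[ePi ePj].
    by case/eqP: nij; rewrite (Pdisj i j e).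
  + by apply/imsetP=> -[i _ P0]; have [e] := Pn0 i; rewrite -P0 inE.
- move=> i; set F := E :\: _; have FE : F \subset E by apply: subsetDl.
  have PF : P i \subset F.
    apply/subsetP=> e ePi; rewrite inE; apply/andP; split.
      apply/negP=> /bigcupP[j ji /(Pdisj i j e ePi) ij].
      by rewrite ij ltnn in ji.
    by move: ePi; rewrite inE => /andP[].
  split=> //.
  + apply/trivIsetP=> e f; rewrite !inE => /andP[eE /eqP ce] /andP[fE /eqP cf] ef.
    apply/pred0P=> u /=; apply/negP=> /andP[ue uf].
    by case/eqP: ef; apply: (Hc e f u) => //; rewrite ce cf.
  + have [w Hw] := sign_pattern_realizable peelE R (fun e => e \in P i) gt1 FE.
    exists w; split=> e; last first.
      by rewrite inE => /andP[ePi /Hw]; rewrite /= (negPf ePi).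
    by move=> ePi; have := Hw e (subsetP PF e ePi); rewrite /= ePi.
Qed.

Theorem theorem1p4 (R : realType) (V : finType) (k : nat) (E : {set {set V}})
    (hk : 2 <= k) (hunif : uniform k E) (htree : tree E)
    (hnls : not_linear_space E) :
  pmd_is R E (max_degree E).
Proof.
split; last by move=> q; apply: has_pmd_max_degree_le.
apply: peelable_has_pmd; first by move=> e /hunif ->.
by move=> F; apply: exists_leaf.
Qed.
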